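(* Let $V=[v_1,\ldots,v_n]\in\mathbb{R}^{d\times n}$, $\lambda\ge0$, $c>0$, $\alpha>0$, let $x\in[0,1]^n$, and let $\mu$ be a distribution on $\mathcal{U}\in\{\mathcal{U}_k,\mathcal{U}_{\leq k}\}$ that is $(c,\alpha)$-near-pairwise independent with respect to $x$, i.e. for all $T,R\subseteq[n]$ each of size at most $d$, \[ \frac{\Pr_{\mathcal{S}\sim\mu}[\mathcal{S}\supseteq T]}{\Pr_{\mathcal{S}\sim\mu}[\mathcal{S}\supseteq R]}\leq c\,\alpha^{|R|-|T|}\frac{x^T}{x^R}. \] Let $\mu'$ be the distribution on $\mathcal{U}$ with $\mu'(S)\propto\mu(S)\det(V_SV_S^\top+\lambda I_d)$. Then \[ \mathbb{E}_{\mathcal{S}\sim\mu'}\left[\frac{E_{d-1}(V_{\mathcal{S}}V_{\mathcal{S}}^\top+\lambda I_d)}{E_d(V_{\mathcal{S}}V_{\mathcal{S}}^\top+\lambda I_d)}\right]\leq c\alpha\,\frac{E_{d-1}(V(x)V(x)^\top+\alpha\lambda I_d)}{E_d(V(x)V(x)^\top+\alpha\lambda I_d)}. \]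
   Context: For $S\subseteq[n]$, $V_S$ is the matrix with columns $v_i$, $i\in S$; $V(x)=[\sqrt{x_1}v_1,\ldots,\sqrt{x_n}v_n]$; $x^S=\prod_{i\in S}x_i$. $\mathcal{U}_k$ ($\mathcal{U}_{\le k}$) is the family of subsets of $[n]$ of size exactly $k$ (at most $k$). For a PSD $d\times d$ matrix $M$, $E_j(M)$ is the degree-$j$ elementary symmetric polynomial of its eigenvalues, $E_0(M)=1$. *)

(* Defs.v *)
From HB Require Import structures.
From mathcomp Require Import all_boot all_order all_algebra.
From mathcomp Require Import polyrcf.
From mathcomp Require Import mpoly.
Set Implicit Arguments.
Unset Strict Implicit.
Unset Printing Implicit Defensive.
Import Order.TTheory GRing.Theory Num.Theory.
Local Open Scope ring_scope.

(* The real eigenvalues of M, listed with their algebraic multiplicity. For   *)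
(* the symmetric matrices considered here these are all the eigenvalues.      *)
Definition eigenvalues (R : rcfType) (d : nat) (M : 'M[R]_d) : seq R :=
  flatten [seq nseq (mup a (char_poly M)) a | a <- rootsR (char_poly M)].

Lemma mem_eigenvalues (R : rcfType) (d : nat) (M : 'M[R]_d) (a : R) :
  (a \in eigenvalues M) = eigenvalue M a.
Proof.
have p0 : char_poly M != 0 by rewrite monic_neq0 // char_poly_monic.
have rootE b : (b \in rootsR (char_poly M)) = root (char_poly M) b.
  by rewrite -(roots_on_rootsR p0) in_itv.
rewrite eigenvalue_root_char; apply/flatten_mapP/idP => [[b]|ra].
  by rewrite rootE => rb /nseqP[-> _].
by exists a; rewrite ?rootE // mem_nseq -XsubC_dvd // dvdp_XsubCl ra eqxx.
Qed.

Definition esymE (R : rcfType) (d : nat) (j : nat) (M : 'M[R]_d) : R :=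
  (mesym (size (eigenvalues M)) R j).@[fun i => (eigenvalues M)`_i].

Definition subsets_eq (n k : nat) : {set {set 'I_n}} :=
  [set S : {set 'I_n} | #|S| == k].

Definition subsets_le (n k : nat) : {set {set 'I_n}} :=
  [set S : {set 'I_n} | (#|S| <= k)%N].

Definition distribution (R : rcfType) (T : finType) (U : {set T})
    (mu : T -> R) : Prop :=
  [/\ forall s, 0 <= mu s,
      forall s, s \notin U -> mu s = 0
    & \sum_s mu s = 1].

Definition Pr (R : rcfType) (T : finType) (mu : T -> R) (A : pred T) : R :=
  \sum_(s | A s) mu s.

Definition expectation (R : rcfType) (T : finType) (mu f : T -> R) : R :=
  \sum_s mu s * f s.

(* A probability distribution mu' that is proportional to w exists only if w  *)
(* has nonzero total mass, and is then w divided by that mass.                *)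
Definition proportional (R : rcfType) (T : finType) (mu' w : T -> R) : Prop :=
  exists K : R, forall s, mu' s = K * w s.

Definition cols (R : rcfType) (d n : nat) (V : 'M[R]_(d, n)) (S : {set 'I_n}) :
    'M[R]_(d, #|S|) :=
  colsub (fun i : 'I_#|S| => enum_val i) V.

Definition scaled_cols (R : rcfType) (d n : nat) (V : 'M[R]_(d, n))
    (x : 'I_n -> R) : 'M[R]_(d, n) :=
  \matrix_(i, j) (Num.sqrt (x j) * V i j).

Definition monomial (R : rcfType) (n : nat) (x : 'I_n -> R) (S : {set 'I_n}) :
    R :=
  \prod_(i in S) x i.

(* The ratio Pr[T \subset S] / Pr[Q \subset S] is at most                     *)
(* c alpha^(|Q| - |T|) x^T / x^Q, with both denominators cleared because      *)
(* either may vanish (x may have zero coordinates). The convention y / 0 = 0  *)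
(* would instead impose nothing when Pr[Q \subset S] = 0, even if             *)
(* Pr[T \subset S] > 0 and x^Q > 0.                                           *)
Definition near_pairwise_independent (R : rcfType) (d n : nat) (c alpha : R)
    (x : 'I_n -> R) (mu : {set 'I_n} -> R) : Prop :=
  forall T Q : {set 'I_n}, (#|T| <= d)%N -> (#|Q| <= d)%N ->
    Pr mu (fun S => T \subset S) * monomial x Q
      <= c * alpha ^ (#|Q|%:Z - #|T|%:Z) * monomial x T
         * Pr mu (fun S => Q \subset S).

Lemma near_pairwise_ratioE (R : rcfType) (n : nat) (c alpha : R)
    (x : 'I_n -> R) (mu : {set 'I_n} -> R) (T Q : {set 'I_n}) :
  0 < Pr mu (fun S => Q \subset S) -> 0 < monomial x Q ->
  (Pr mu (fun S => T \subset S) * monomial x Q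
     <= c * alpha ^ (#|Q|%:Z - #|T|%:Z) * monomial x T
        * Pr mu (fun S => Q \subset S))
  = (Pr mu (fun S => T \subset S) / Pr mu (fun S => Q \subset S)
     <= c * alpha ^ (#|Q|%:Z - #|T|%:Z) * (monomial x T / monomial x Q)).
Proof.
move=> PQ xQ.
by rewrite ler_pdivrMr // [in RHS]mulrA [X in _ = (_ <= X)]mulrAC ler_pdivlMr.
Qed.

(* Main.v *)
(** With [p_y(t) = det (V diag(y) V^T + t I)], the two symmetric functions at
    [V diag(y) V^T + t I] are [E_d = p_y(t)] and [E_(d-1) = p_y'(t)], because a
    real symmetric matrix has all its eigenvalues in [R].  Cauchy-Binet applied
    to [[I, V] diag(t, .., t, y) [I, V]^T] gives
    [p_y(t) = \sum_T w_T t^(d - |T|) y^T] with weights [w_T >= 0] that do not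
    depend on [y] and [t].  Taking for [y] the indicator of [S] and averaging
    over [mu] replaces [y^T] by [Pr[T \subset S]]; after clearing denominators
    the claim is a double sum over [(T, Q)] in which near-pairwise independence
    applies term by term. *)
Require Import Defs.
From HB Require Import structures.
From mathcomp Require Import all_boot all_order all_algebra.
From mathcomp Require Import perm complex polyrcf mpoly ring.
Import Order.TTheory GRing.Theory Num.Theory.
Local Open Scope ring_scope.

Set Implicit Arguments.
Unset Strict Implicit.

(** * Factorisation of the characteristic polynomial of a real symmetric matrix *)

Lemma char_poly_similar (F : fieldType) (d : nat) (P A : 'M[F]_d) :
  P \in unitmx -> char_poly (invmx P *m A *m P) = char_poly A.
Proof.
move=> uP; have polyCK : map_mx polyC (invmx P) *m map_mx polyC P = 1%:M.
  by rewrite -map_mxM mulVmx // map_mx1.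
have -> : char_poly (invmx P *m A *m P)
    = \det (map_mx polyC (invmx P) *m char_poly_mx A *m map_mx polyC P).
  congr (\det _); rewrite /char_poly_mx mulmxBr mulmxBl !map_mxM.
  by rewrite -(mulmxA _ 'X%:M) -scalar_mxC mulmxA polyCK mul1mx.
rewrite !det_mulmx mulrC mulrA -det_mulmx -map_mxM mulmxV //.
by rewrite map_mx1 det1 mul1r.
Qed.

(** Over the complexification [M] becomes Hermitian, so the spectral theorem diagonalises it with
    real entries. The factorisation descends because [toC] is injective on polynomials. *)
Lemma char_poly_sym_split (R : rcfType) (d : nat) (M : 'M[R]_d) :
  M^T = M -> exists s : seq R, char_poly M = \prod_(a <- s) ('X - a%:P).
Proof.
move=> Msym; pose toC := real_complex R; pose MC := map_mx toC M.
have MCsym : MC \is symmetricmx.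
  by apply/is_hermitianmxP; rewrite expr0 scale1r map_mx_id // map_trmx Msym.
have MCreal : MC \is a realmx.
  by apply/mxOverP => i j; rewrite mxE; apply/complex_realP; exists (M i j).
have MCherm : MC \is hermsymmx by apply: realsym_hermsym.
have /orthomx_spectralP MCE := hermitian_normalmx MCherm.
have /mxOverP Dreal := hermitian_spectral_diag_real MCherm.
exists [seq complex.Re (spectral_diag MC 0 i) | i <- enum 'I_d].
apply: (map_poly_inj toC); rewrite map_char_poly -/MC [in LHS]MCE.
rewrite char_poly_similar ?spectral_unit // char_poly_trig ?diag_mx_is_trig //.
rewrite rmorph_prod big_map big_enum; apply: eq_bigr => i _ /=.
rewrite rmorphB /= map_polyX map_polyC mxE eqxx mulr1n /=.
by rewrite -(RRe_real (Dreal 0 i)).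
Qed.

(** In both lists each [a] occurs as often as its multiplicity as a root of [char_poly M]. *)
Lemma perm_eigenvalues (R : rcfType) (d : nat) (M : 'M[R]_d) (s : seq R) :
  char_poly M = \prod_(a <- s) ('X - a%:P) -> perm_eq (eigenvalues M) s.
Proof.
move=> Ms; have p0 : char_poly M != 0 by rewrite monic_neq0 ?char_poly_monic.
have rootE b : (b \in rootsR (char_poly M)) = root (char_poly M) b.
  by rewrite -(roots_on_rootsR p0) in_itv.
apply/allP => a _ /=; apply/eqP; rewrite -[RHS]mu_prod_XsubC -Ms /eigenvalues.
rewrite count_flatten -map_comp sumnE big_map.
rewrite (eq_bigr (fun b => (a == b) * mup a (char_poly M)))%N; last first.
  move=> b _ /=; rewrite count_nseq /= eq_sym.
  by have [->|] := eqVneq a b; rewrite ?mul0n.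
have [ra|ra] := boolP (a \in rootsR (char_poly M)).
  rewrite (bigD1_seq a) ?uniq_roots //= eqxx mul1n big1 ?addn0 // => b.
  by rewrite eq_sym => /negPf->.
rewrite big1_seq => [|b /= br]; last first.
  by have [ab|] := eqVneq a b; rewrite ?mul0n //; rewrite ab br in ra.
by apply/esym/eqP; rewrite -leqn0 leqNgt -XsubC_dvd // dvdp_XsubCl -rootE.
Qed.

(** Vieta's formulas for the split characteristic polynomial. *)
Lemma esymE_char_poly (R : rcfType) (d : nat) (M : 'M[R]_d) (j : nat) :
  M^T = M -> (j <= d)%N -> esymE j M = (-1) ^+ j * (char_poly M)`_(d - j).
Proof.
move=> /char_poly_sym_split[s Ms] le_jd.
have {Ms} : char_poly M = \prod_(a <- eigenvalues M) ('X - a%:P).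
  by rewrite Ms; apply/perm_big; rewrite perm_sym perm_eigenvalues.
rewrite /esymE; move: (eigenvalues M) => {}s Ms.
have sz : size s = d.
  by apply/succn_inj; rewrite -(size_char_poly M) Ms size_prod_XsubC.
rewrite Ms -{}sz in le_jd *; rewrite (meval_eq (v2 := tnth (in_tuple s))).
  rewrite (mroots_coeff (in_tuple s) (Ordinal (le_jd : j < (size s).+1)%N)).
  by rewrite mulrA -expr2 sqrr_sign mul1r.
by move=> i; rewrite (tnth_nth 0).
Qed.

(** * Symmetric functions of a shifted matrix through a determinant polynomial *)

Lemma poly_eq_horner (R : numDomainType) (p q : {poly R}) :
  (forall t, p.[t] = q.[t]) -> p = q.
Proof.
move=> pq; apply/eqP; rewrite -subr_eq0; apply/eqP.
apply: (@roots_geq_poly_eq0 _ _ [seq i%:R | i <- iota 0 (size (p - q))]).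
- by apply/allP => t _; rewrite rootE !hornerE pq subrr.
- by rewrite map_inj_uniq ?iota_uniq //; apply: mulrIn; rewrite oner_neq0.
- by rewrite size_map size_iota.
Qed.

Lemma horner_char_poly (R : comNzRingType) (d : nat) (M : 'M[R]_d) (t : R) :
  (char_poly M).[t] = \det (t%:M - M).
Proof.
rewrite -horner_evalE -det_map_mx; congr (\det _).
apply/matrixP => i j; rewrite !mxE /=.
by rewrite /horner_eval hornerD hornerN hornerC hornerMn hornerX.
Qed.

Lemma char_poly_shift (R : numDomainType) (d : nat) (A : 'M[R]_d) (l : R)
    (p : {poly R}) :
  (forall t, p.[t] = \det (A + t%:M)) ->
  char_poly (A + l%:M) = (-1) ^+ d *: (p \Po (l%:P - 'X)).
Proof.
move=> pA; apply: poly_eq_horner => t.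
rewrite horner_char_poly hornerZ horner_comp pA !hornerE -detZ.
congr (\det _); apply/matrixP => i j; rewrite !mxE mulrnBl; ring.
Qed.

Lemma esymE_shift (R : rcfType) (d : nat) (A : 'M[R]_d) (l : R) (p : {poly R}) :
  A^T = A -> (forall t, p.[t] = \det (A + t%:M)) ->
  esymE d (A + l%:M) = p.[l].
Proof.
move=> Asym pA; rewrite esymE_char_poly // ?linearD /= ?Asym ?tr_scalar_mx //.
rewrite subnn (char_poly_shift _ pA) coefZ mulrA -expr2 sqrr_sign mul1r.
by rewrite -horner_coef0 horner_comp !hornerE subr0.
Qed.

(** Up to sign, [E_(d-1)] is the linear coefficient of the characteristic polynomial; the inner
    derivative of [l - X] supplies the missing sign. *)
Lemma esymE_pred_shift (R : rcfType) (d : nat) (A : 'M[R]_d) (l : R)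
    (p : {poly R}) :
  (0 < d)%N -> A^T = A -> (forall t, p.[t] = \det (A + t%:M)) ->
  esymE d.-1 (A + l%:M) = p^`().[l].
Proof.
case: d A => // d A _ Asym pA /=.
rewrite esymE_char_poly // ?linearD /= ?Asym ?tr_scalar_mx // subSnn.
rewrite (char_poly_shift _ pA) coefZ; set q := _ \Po _.
have -> : (q`_1) = q^`().[0] by rewrite horner_coef0 coef_deriv mulr1n.
rewrite deriv_comp derivB derivC derivX sub0r mulrN1 hornerN horner_comp.
rewrite hornerD hornerN hornerC hornerX subr0 exprS mulN1r mulrNN mulrA.
by rewrite -expr2 sqrr_sign mul1r.
Qed.

(** * Cauchy-Binet expansion of the shifted Gram determinant *)

(* Indexing by all maps rather than by increasing ones costs the factor [d`!] *)
(* and needs no enumeration of subsets.                                       *)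
Lemma Cauchy_Binet (R : comNzRingType) (d m : nat) (A : 'M[R]_(d, m))
    (B : 'M[R]_(m, d)) :
  d`!%:R * \det (A *m B)
    = \sum_(f : {ffun 'I_d -> 'I_m}) \det (colsub f A) * \det (rowsub f B).
Proof.
have detAB : \det (A *m B)
    = \sum_(f : {ffun 'I_d -> 'I_m}) (\prod_i A i (f i)) * \det (rowsub f B).
  pose AB (s : 'S_d) i j := A i j * B j (s i).
  transitivity (\sum_(f : {ffun 'I_d -> 'I_m})
      \sum_(s : 'S_d) (-1) ^+ s * \prod_i AB s i (f i)).
    rewrite exchange_big; apply: eq_bigr => /= s _; rewrite -big_distrr /=.
    congr (_ * _); rewrite -(bigA_distr_bigA (AB s)) /=.
    by apply: eq_bigr => i _; rewrite mxE.
  apply: eq_bigr => f _; rewrite big_distrr /=; apply: eq_bigr => s _.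
  rewrite big_split /= mulrCA; congr (_ * (_ * _)).
  by apply: eq_bigr => i _; rewrite mxE.
(* Precomposing [f] with [s] permutes the rows of [rowsub f B] at the price of a sign; summing over
   all [s] then rebuilds [\det (colsub f A)]. *)
have shuffle (s : 'S_d) : \det (A *m B)
    = \sum_(f : {ffun 'I_d -> 'I_m})
        ((-1) ^+ s * \prod_i colsub f A i (s i)) * \det (rowsub f B).
  pose h (f : {ffun 'I_d -> 'I_m}) := [ffun i => f (s i)].
  have hK : bijective h.
    exists (fun f : {ffun 'I_d -> 'I_m} => [ffun i => f (s^-1%g i)]) => f.
      by apply/ffunP => i; rewrite !ffunE permKV.
    by apply/ffunP => i; rewrite !ffunE permK.
  rewrite detAB (reindex h); last exact: onW_bij.
  apply: eq_bigr => f _.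
  have -> : rowsub (h f) B = row_perm s (rowsub f B).
    by apply/matrixP => i j; rewrite !mxE ffunE.
  rewrite row_permE det_mulmx det_perm [LHS]mulrCA [LHS]mulrA.
  by congr (_ * _ * _); apply: eq_bigr => i _; rewrite mxE ffunE.
rewrite mulrC mulr_natr -card_Sn -sumr_const.
rewrite (eq_bigr _ (fun s _ => shuffle s)) exchange_big /=.
by apply: eq_bigr => f _; rewrite -mulr_suml.
Qed.

(* The maps [f] choose columns of the block matrix [[I, V]]; this is the set  *)
(* of columns of [V] among them.                                              *)
Definition rpart (d n : nat) (f : {ffun 'I_d -> 'I_(d + n)}) : {set 'I_n} :=
  [set j | rshift d j \in f @: setT].

(** Stated for any commutative monoid because it serves both to count columns and to split the
    product of the diagonal entries. *)
Lemma big_inj_split (M : Type) (idx : M) (op : Monoid.com_law idx) (d n : nat)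
    (f : {ffun 'I_d -> 'I_(d + n)}) (F : 'I_(d + n) -> M) :
  injective f ->
  \big[op/idx]_i F (f i)
    = op (\big[op/idx]_(i | lshift n i \in f @: setT) F (lshift n i))
         (\big[op/idx]_(j in rpart f) F (rshift d j)).
Proof.
move=> f_inj; transitivity (\big[op/idx]_(k in f @: setT) F k).
  rewrite big_imset => [|i j _ _ /f_inj //].
  by apply: eq_bigl => i; rewrite inE.
by rewrite big_split_ord /=; congr (op _ _); apply: eq_bigl => j; rewrite inE.
Qed.

Lemma card_rpart (d n : nat) (f : {ffun 'I_d -> 'I_(d + n)}) :
  injective f ->
  (#|[pred i | lshift n i \in f @: setT]| + #|rpart f| = d)%N.
Proof.
move=> f_inj; rewrite -!sum1_card -(big_inj_split _ (fun=> 1%N) f_inj).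
by rewrite sum1_card card_ord.
Qed.

Lemma det_shifted_gram (R : rcfType) (d n : nat) (V : 'M[R]_(d, n)) :
  exists w : {set 'I_n} -> R, (forall T, 0 <= w T) /\
    forall (y : 'I_n -> R) (t : R),
      \det (V *m diag_mx (\row_j y j) *m V^T + t%:M)
        = \sum_(T : {set 'I_n} | (#|T| <= d)%N)
            w T * (t ^+ (d - #|T|) * monomial y T).
Proof.
pose W := row_mx 1%:M V.
pose minor (f : {ffun 'I_d -> 'I_(d + n)}) := \det (colsub f W).
(* Squared maximal minors of [[I, V]], grouped by the columns taken from [V]; the factorial undoes
   the counting of all orderings of a column set. *)
exists (fun T => d`!%:R^-1 * \sum_(f : {ffun 'I_d -> 'I_(d + n)}
                     | injectiveb f && (rpart f == T)) minor f ^+ 2).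
split=> [T|y t].
  by rewrite mulr_ge0 ?invr_ge0 ?ler0n // sumr_ge0 // => f _; apply: sqr_ge0.
have fact_unit : d`!%:R != 0 :> R by rewrite pnatr_eq0 -lt0n fact_gt0.
pose Y (k : 'I_(d + n)) := match split k with inl _ => t | inr j => y j end.
have -> : V *m diag_mx (\row_j y j) *m V^T + t%:M
    = row_mx t%:M (V *m diag_mx (\row_j y j)) *m W^T.
  by rewrite tr_row_mx mul_row_col trmx1 mulmx1 addrC.
apply: (mulfI fact_unit); rewrite Cauchy_Binet mulr_sumr.
have term (f : {ffun 'I_d -> 'I_(d + n)}) :
    \det (colsub f (row_mx t%:M (V *m diag_mx (\row_j y j))))
      * \det (rowsub f W^T)
    = minor f ^+ 2 * \prod_i Y (f i).
  have -> : rowsub f W^T = (colsub f W)^T by apply/matrixP => i j; rewrite !mxE.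
  have -> : colsub f (row_mx t%:M (V *m diag_mx (\row_j y j)))
      = colsub f W *m diag_mx (\row_i Y (f i)).
    rewrite !mul_mx_diag; apply/matrixP => i j; rewrite !mxE /Y.
    by case: (split _) => k; rewrite !mxE ?mulr_natl.
  rewrite det_mulmx det_tr det_diag expr2 mulrAC; congr (_ * _).
  by apply: eq_bigr => i _; rewrite mxE.
rewrite (eq_bigr _ (fun f _ => term f)).
(* A map that is not injective repeats a column, so its minor vanishes. *)
rewrite (bigID (fun f : {ffun 'I_d -> 'I_(d + n)} => injectiveb f)) /=.
rewrite [X in _ + X]big1 ?addr0 => [|f /injectivePn[i [j ij fij]]]; last first.
  rewrite /minor -det_tr (determinant_alternate ij) ?expr0n ?mul0r // => k.
  by rewrite !mxE fij.
rewrite (partition_big (@rpart d n) (fun T => #|T| <= d)%N) /=; last first.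
  by move=> f /injectiveP f_inj; rewrite -[leqRHS](card_rpart f_inj) leq_addl.
apply: eq_bigr => T _; rewrite !mulrA mulfV // mul1r !mulr_suml.
apply: eq_bigr => f /andP[/injectiveP f_inj /eqP fT].
rewrite (big_inj_split _ Y f_inj) -mulrA; congr (_ * (_ * _)).
  rewrite (eq_bigr (fun=> t)) => [|i _]; last first.
    by rewrite /Y (unsplitK (inl _ i)).
  rewrite prodr_const -fT; congr (t ^+ _).
  exact/(canRL (addnK _))/card_rpart.
by rewrite fT; apply: eq_bigr => j _; rewrite /Y (unsplitK (inr _ j)).
Qed.

(** Differentiating in [t] keeps the weights, so one family [w] serves both functions. For [|T| = d]
    the truncated exponent is harmless, since [*+ 0] kills the term. *)
Lemma esym_shifted_gram (R : rcfType) (d n : nat) (V : 'M[R]_(d, n)) :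
  (0 < d)%N ->
  exists w : {set 'I_n} -> R, (forall T, 0 <= w T) /\
    forall (y : 'I_n -> R) (t : R)
      (M := V *m diag_mx (\row_j y j) *m V^T + t%:M),
    [/\ \det M = \sum_(T : {set 'I_n} | (#|T| <= d)%N)
          w T * (t ^+ (d - #|T|) * monomial y T),
        esymE d M = \det M
      & esymE d.-1 M = \sum_(T : {set 'I_n} | (#|T| <= d)%N)
          w T * (t ^+ (d - #|T|).-1 *+ (d - #|T|) * monomial y T)].
Proof.
move=> d_gt0; have [w [w_ge0 wE]] := det_shifted_gram V.
exists w; split=> // y t M; pose A := V *m diag_mx (\row_j y j) *m V^T.
have Asym : A^T = A by rewrite /A !trmx_mul trmxK tr_diag_mx mulmxA.
pose p := \sum_(T : {set 'I_n} | (#|T| <= d)%N)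
  (w T * monomial y T) *: 'X^(d - #|T|).
have pA s : p.[s] = \det (A + s%:M).
  rewrite wE horner_sum; apply: eq_bigr => T _.
  by rewrite hornerZ hornerXn mulrAC mulrA.
split; first exact: wE; first by rewrite /M (esymE_shift _ Asym pA) pA.
rewrite /M (esymE_pred_shift _ d_gt0 Asym pA) raddf_sum horner_sum /=.
apply: eq_bigr => T _.
by rewrite derivZ derivXn hornerZ hornerMn hornerXn mulrAC mulrA.
Qed.

(** * Gram matrices of selected and of rescaled columns *)

Lemma cols_gram (R : rcfType) (d n : nat) (V : 'M[R]_(d, n)) (S : {set 'I_n}) :
  cols V S *m (cols V S)^T
    = V *m diag_mx (\row_j ((j \in S)%:R : R)) *m V^T.
Proof.
apply/matrixP => i k; rewrite mul_mx_diag !mxE.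
rewrite (eq_bigr (fun j => V i (enum_val j) * V k (enum_val j))); last first.
  by move=> j _; rewrite !mxE.
rewrite -(big_enum_val (fun j => V i j * V k j)) /= big_mkcond /=.
apply: eq_bigr => j _; rewrite !mxE.
by case: (j \in S); rewrite ?mulr1 ?mulr0 ?mul0r.
Qed.

Lemma scaled_cols_gram (R : rcfType) (d n : nat) (V : 'M[R]_(d, n))
    (x : 'I_n -> R) :
  (forall j, 0 <= x j) ->
  scaled_cols V x *m (scaled_cols V x)^T = V *m diag_mx (\row_j x j) *m V^T.
Proof.
move=> x_ge0; apply/matrixP => i k; rewrite mul_mx_diag !mxE.
apply: eq_bigr => j _; rewrite !mxE -{3}(sqr_sqrtr (x_ge0 j)); ring.
Qed.

Lemma monomial_indicator (R : rcfType) (n : nat) (S T : {set 'I_n}) :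
  monomial (fun j => (j \in S)%:R : R) T = (T \subset S)%:R.
Proof.
have [/subsetP TS|/subsetPn[j jT /negPf jS]] := boolP (T \subset S).
  by rewrite /monomial big1 // => j /TS->.
by rewrite /monomial (bigD1 j) //= jS mul0r.
Qed.

(** * Normalisation, averaging over [mu] and termwise comparison *)

Theorem theorem3 (R : rcfType) (d n k : nat) (V : 'M[R]_(d, n))
    (lambda c alpha : R) (x : 'I_n -> R) (U : {set {set 'I_n}})
    (mu mu' : {set 'I_n} -> R)
    (d_gt0 : (0 < d)%N)
    (lambda_ge0 : 0 <= lambda) (c_gt0 : 0 < c) (alpha_gt0 : 0 < alpha)
    (x01 : forall i, 0 <= x i <= 1)
    (U_def : U = subsets_eq n k \/ U = subsets_le n k)
    (mu_distr : distribution U mu)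
    (mu_npi : near_pairwise_independent d c alpha x mu)
    (mu'_distr : distribution U mu')
    (mu'_prop : proportional mu'
       (fun S => mu S * \det (cols V S *m (cols V S)^T + lambda%:M))) :
  expectation mu'
    (fun S => esymE d.-1 (cols V S *m (cols V S)^T + lambda%:M)
              / esymE d (cols V S *m (cols V S)^T + lambda%:M))
  <= c * alpha *
     (esymE d.-1 (scaled_cols V x *m (scaled_cols V x)^T + (alpha * lambda)%:M)
      / esymE d (scaled_cols V x *m (scaled_cols V x)^T + (alpha * lambda)%:M)).
Proof.
have x_ge0 j : 0 <= x j by case/andP: (x01 j).
have [w [w_ge0 wE]] := esym_shifted_gram V d_gt0.
have [mu_ge0 _ _] := mu_distr; have [_ _ mu'1] := mu'_distr.
pose P (T : {set 'I_n}) := Pr mu (fun S : {set 'I_n} => T \subset S).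
have P_ge0 T : 0 <= P T by apply: sumr_ge0.
have mon_ge0 T : 0 <= monomial x T by apply: prodr_ge0.
pose F (b g : {set 'I_n} -> R) :=
  \sum_(T : {set 'I_n} | (#|T| <= d)%N) w T * (b T * g T).
have F_ge0 b g : (forall T, 0 <= b T) -> (forall T, 0 <= g T) -> 0 <= F b g.
  by move=> b0 g0; apply: sumr_ge0 => T _; rewrite !mulr_ge0.
pose top t (T : {set 'I_n}) : R := t ^+ (d - #|T|).
pose pretop t (T : {set 'I_n}) : R := t ^+ (d - #|T|).-1 *+ (d - #|T|).
have top_ge0 t T : 0 <= t -> 0 <= top t T by apply: exprn_ge0.
have pretop_ge0 t T : 0 <= t -> 0 <= pretop t T.
  by move=> t_ge0; rewrite mulrn_wge0 ?exprn_ge0.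
pose ind (S T : {set 'I_n}) : R := (T \subset S)%:R.
have mu_F b : \sum_S mu S * F b (ind S) = F b P.
  under eq_bigr do rewrite mulr_sumr.
  rewrite exchange_big; apply: eq_bigr => T _ /=.
  rewrite /P /Pr [in RHS]big_mkcond !mulr_sumr; apply: eq_bigr => S _.
  by rewrite /ind; case: (T \subset S) => /=; ring.
have colsE S :
  [/\ \det (cols V S *m (cols V S)^T + lambda%:M) = F (top lambda) (ind S),
    esymE d (cols V S *m (cols V S)^T + lambda%:M) = F (top lambda) (ind S)
  & esymE d.-1 (cols V S *m (cols V S)^T + lambda%:M)
      = F (pretop lambda) (ind S)].
  rewrite cols_gram; have [DE -> ->] := wE (fun j => (j \in S)%:R) lambda.
  by rewrite DE; split; apply: eq_bigr => T _; rewrite monomial_indicator.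
rewrite scaled_cols_gram //; have [DE -> ->] := wE x (alpha * lambda).
rewrite {}DE -/(F (top _) (monomial x)) -/(F (pretop _) (monomial x)).
have [K muK] := mu'_prop.
(* The total mass of [mu'] identifies [K] as an inverse and keeps [F (top lambda) P] from
   vanishing. *)
have KD : K * F (top lambda) P = 1.
  rewrite -mu'1 -mu_F mulr_sumr; apply: eq_bigr => S _.
  by rewrite muK; have [-> _ _] := colsE S.
have topP_gt0 : 0 < F (top lambda) P.
  rewrite lt_def F_ge0 ?andbT => [|T|//]; last exact: top_ge0.
  by apply: contra_eq_neq KD => ->; rewrite mulr0 eq_sym oner_neq0.
have K_gt0 : 0 < K by rewrite -(pmulr_lgt0 _ topP_gt0) KD ltr01.
have lhs_le : expectation mu'
    (fun S => esymE d.-1 (cols V S *m (cols V S)^T + lambda%:M)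
              / esymE d (cols V S *m (cols V S)^T + lambda%:M))
    <= K * F (pretop lambda) P.
  rewrite -mu_F mulr_sumr; apply: ler_sum => S _; rewrite muK.
  have [-> -> ->] := colsE S.
  (* Where the determinant vanishes, so does [mu' S], while the term on the right is merely
     nonnegative; elsewhere the determinant cancels the denominator. *)
  have [->|DS] := eqVneq (F (top lambda) (ind S)) 0; last first.
    by rewrite [X in _ * X <= _]mulrC !mulrA mulfK.
  rewrite invr0 !mulr0 mulr_ge0 ?(ltW K_gt0) // mulr_ge0 // F_ge0 // => T;
    by rewrite ?pretop_ge0 /ind ?ler0n.
apply: (le_trans lhs_le).
(* Near-pairwise independence times [alpha ^+ (d - |Q|)], which leaves only natural exponents of
   [alpha]. *)
have cross (T Q : {set 'I_n}) : (#|T| <= d)%N -> (#|Q| <= d)%N ->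
    P T * (alpha ^+ (d - #|Q|) * monomial x Q)
      <= c * (alpha ^+ (d - #|T|) * monomial x T) * P Q.
  move=> Td Qd; have -> : alpha ^+ (d - #|T|)
      = alpha ^ (#|Q|%:Z - #|T|%:Z) * alpha ^+ (d - #|Q|).
    rewrite !exprnP -expfzDr ?gt_eqF // -!subzn //; congr (_ ^ _); ring.
  have := ler_wpM2l (exprn_ge0 (d - #|Q|) (ltW alpha_gt0)) (mu_npi T Q Td Qd).
  by congr (_ <= _); rewrite /P; ring.
have topM T : top (alpha * lambda) T = alpha ^+ (d - #|T|) * top lambda T.
  exact: exprMn.
(* Differentiation loses one power of [alpha]; this is the source of the factor [alpha] in the
   bound. *)
have pretopM T :
    alpha * pretop (alpha * lambda) T = alpha ^+ (d - #|T|) * pretop lambda T.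
  rewrite /pretop; case: (d - #|T|)%N => [|a]; first by rewrite !mulr0n !mulr0.
  by rewrite exprMn exprS !mulrnAr !mulrA.
have al_ge0 : 0 <= alpha * lambda by rewrite mulr_ge0 // ltW.
(* The case [Q = set0] of [cross] bounds [F (top lambda) P] by a multiple of  *)
(* the right-hand denominator, which therefore cannot vanish.                 *)
have topx_gt0 : 0 < F (top (alpha * lambda)) (monomial x).
  rewrite lt_def F_ge0 ?andbT => [|T|//]; last exact: top_ge0.
  apply: contraTneq topP_gt0 => Fx0; rewrite -leNgt.
  rewrite -(pmulr_rle0 _ (exprn_gt0 d alpha_gt0)).
  apply: (@le_trans _ _ (c * P set0 * F (top (alpha * lambda)) (monomial x))).
    rewrite [leLHS]mulr_sumr [leRHS]mulr_sumr.
    apply: ler_sum => T Td; rewrite topM.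
    have := cross T set0 Td; rewrite cards0 subn0 => /(_ isT).
    rewrite [monomial x set0]big_set0 mulr1.
    move=> /(ler_wpM2l (mulr_ge0 (w_ge0 T) (top_ge0 lambda T lambda_ge0))).
    by congr (_ <= _); ring.
  by rewrite Fx0 mulr0.
have -> : K = (F (top lambda) P)^-1.
  by rewrite -[LHS](mulfK (lt0r_neq0 topP_gt0)) KD mul1r.
rewrite mulrC mulrA ler_pdivlMr // mulrAC ler_pdivrMr //.
rewrite /F [leLHS]mulr_suml [X in _ <= X * _]mulr_sumr [leRHS]mulr_suml.
(* [T] indexes both derivative sums and [Q] both determinant sums, so the two sides share
   [coef_ge0]'s factor and differ as in [cross]. *)
apply: ler_sum => T Td.
rewrite [leLHS]mulr_sumr [leRHS]mulr_sumr; apply: ler_sum => Q Qd.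
have coef_ge0 : 0 <= w T * pretop lambda T * (w Q * top lambda Q).
  by rewrite !mulr_ge0 ?top_ge0 ?pretop_ge0.
have := ler_wpM2l coef_ge0 (cross T Q Td Qd); rewrite topM.
have -> : c * alpha * (w T * (pretop (alpha * lambda) T * monomial x T))
    = c * w T * monomial x T * (alpha * pretop (alpha * lambda) T) by ring.
by rewrite pretopM; congr (_ <= _); ring.
Qed.
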